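(* Let $P_1$ and $P_2$ be projections on a separable complex Hilbert space $\mathcal{H}$. Then $$\mathcal{H}_u = \ker (P_1 P_2 - I) = \operatorname{ran} P_1 \cap \operatorname{ran} P_2,$$ where $\mathcal{H}_u$ is the unitary part of the contraction $P_1 P_2$.
   Context: A projection is an orthogonal projection: $P \in \mathcal{B}(\mathcal{H})$ with $P = P^* = P^2$. For a contraction $T \in \mathcal{B}(\mathcal{H})$ (i.e. $\|Th\| \le \|h\|$ for all $h$), the canonical (Nagy-Foias and Langer) decomposition is the unique orthogonal decomposition $\mathcal{H} = \mathcal{H}_u \oplus \mathcal{H}_{cnu}$ such that both $\mathcal{H}_u$ and $\mathcal{H}_{cnu}$ reduce $T$, $T|_{\mathcal{H}_u}$ is unitary, and $T|_{\mathcal{H}_{cnu}}$ is completely non-unitary (it has no nontrivial unitary summand). The space $\mathcal{H}_u$ is called the unitary part of $T$ and is given by $\mathcal{H}_u = \{h \in \mathcal{H}: \|T^m h\| = \|T^{*m} h\| = \|h\| \text{ for all } m \in \mathbb{N}\}$. *)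

(* Defs.v *)
From HB Require Import structures.
From mathcomp Require Import all_boot all_order all_algebra.
From mathcomp Require Import all_classical all_reals all_analysis.
From mathcomp Require Import sesquilinear complex.

Set Implicit Arguments.
Unset Strict Implicit.
Unset Printing Implicit Defensive.

Import Order.TTheory GRing.Theory Num.Theory.
Import numFieldNormedType.Exports.

Local Open Scope classical_set_scope.
Local Open Scope ring_scope.
Local Open Scope complex_scope.

(* A complex Hilbert space is a complete normed space over R[i] together with
   an inner product inducing its norm. Inner products are linear in the first
   argument and conjugate-linear in the second. *)
Definition induces_norm (R : realType) (H : completeNormedModType R[i])
    (dot : {dot H for Num.conj}) : Prop :=
  forall x : H, dot x x = `|x| ^+ 2.

Definition separable (T : topologicalType) : Prop :=
  exists2 A : set T, countable A & dense A.

Section HilbertSpaceOperators.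
Context (R : realType) (H : completeNormedModType R[i]).
Context (dot : {dot H for Num.conj}).
Implicit Types (K M N : set H) (S T : H -> H).

(* The conditions P \in B(H), P = P^* and P = P^2. *)
Definition projection (P : {linear H -> H}) : Prop :=
  [/\ continuous P,
      forall x y, dot (P x) y = dot x (P y) &
      forall x, P (P x) = P x].

Definition closed_subspace M : Prop :=
  [/\ closed M, M 0 & forall (a : R[i]) x y, M x -> M y -> M (a *: x + y)].

Definition ortho_compl_in K M : set H :=
  [set x | K x /\ forall y, M y -> dot x y = 0].

(* M reduces the restriction of T to K, for a closed subspace K invariant
   under T; K = setT is the usual notion. *)
Definition reduces_in K T M : Prop :=
  [/\ closed_subspace M, M `<=` K, T @` M `<=` M &
      T @` ortho_compl_in K M `<=` ortho_compl_in K M].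

Definition reduces T M : Prop := reduces_in setT T M.

(* T restricts to an operator U on M such that U^* U = U U^* = I_M; here S
   plays the role of U^*, and only its values on M matter. *)
Definition unitary_on T M : Prop :=
  T @` M `<=` M /\
  exists S, [/\ S @` M `<=` M,
    forall x y, M x -> M y -> dot (T x) y = dot x (S y),
    forall x, M x -> S (T x) = x &
    forall x, M x -> T (S x) = x].

Definition completely_non_unitary_on T K : Prop :=
  forall N, reduces_in K T N -> unitary_on T N -> N = [set 0].

Definition orthogonal_decomposition M N : Prop :=
  (forall x y, M x -> N y -> dot x y = 0) /\
  (forall h, exists x y, [/\ M x, N y & h = x + y]).

Definition canonical_decomposition T Hu Hcnu : Prop :=
  [/\ orthogonal_decomposition Hu Hcnu,
      reduces T Hu, reduces T Hcnu,
      unitary_on T Hu &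
      completely_non_unitary_on T Hcnu].

(* A definite description: every contraction has exactly one canonical
   decomposition. The default value set0 is not a subspace. *)
Definition unitary_part T : set H :=
  xget set0 [set Hu | exists Hcnu, canonical_decomposition T Hu Hcnu].

End HilbertSpaceOperators.

Definition ker (U V : zmodType) (f : U -> V) : set U := [set x | f x = 0].

(* Main.v *)
Require Import Defs.
From HB Require Import structures.
From mathcomp Require Import all_boot all_order all_algebra.
From mathcomp Require Import all_classical all_reals all_analysis.
From mathcomp Require Import sesquilinear complex.
Import Order.TTheory GRing.Theory Num.Theory.
Import numFieldNormedType.Exports.
Local Open Scope classical_set_scope.
Local Open Scope ring_scope.
Local Open Scope complex_scope.

(** Write T for the product P1 P2 and U for the intersection of the two ranges,
    that is, for the common fixed space of P1 and P2.

    A projection shortens every vector that it moves, since x splits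
    orthogonally as P x + (x - P x). Hence any x with |P1 P2 x| >= |x| is fixed
    by P2 and then by P1 (common_range_isometric). This gives ker (T - I) = U,
    and it also shows that every subspace on which T is unitary lies in U.
    As T is the identity on U, the space U is thus the largest subspace on which
    T is unitary.

    The unitary part is defined as the first summand of a canonical
    decomposition, so two facts remain. Existence: U together with its
    orthogonal complement is a canonical decomposition
    (canonical_decomposition_common_range). The only analytic point is that they
    span the space (common_range_decomposition). Instead of a general projection
    theorem, the summand of h in U is obtained as a limit of alternating
    projections, following von Neumann: it is the limit of A^(2n) h for the
    self-adjoint contraction A = P1 P2 P1. Uniqueness: if (Hu, Hcnu) is
    canonical, then Hu is contained in U by the above, and U intersected with
    Hcnu reduces the restriction of T to Hcnu while T is the identity on this
    intersection, so the intersection is zero by complete non-unitarity. As U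
    contains Hu, this forces U = Hu
    (canonical_decomposition_unique). *)

(** * Inner products and self-adjoint contractions *)

Section InnerProduct.
Set Implicit Arguments.
Unset Strict Implicit.
Context (R : realType) (H : completeNormedModType R[i]).
Context (dot : {dot H for Num.conj}) (dot_norm : induces_norm dot).
Implicit Types (x y h : H) (M : set H).

Lemma dotC x y : dot x y = (dot y x)^*%R.
Proof. by have := hermC dot x y; rewrite expr0 mul1r. Qed.

Lemma dot0l y : dot 0 y = 0. Proof. exact: linear0l. Qed.

Lemma dot0r x : dot x 0 = 0. Proof. exact: linear0r. Qed.

Lemma dotDl x1 x2 y : dot (x1 + x2) y = dot x1 y + dot x2 y.
Proof. exact: linearDl. Qed.

Lemma dotBl x1 x2 y : dot (x1 - x2) y = dot x1 y - dot x2 y.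
Proof. exact: linearBl. Qed.

Lemma dotBr x y1 y2 : dot x (y1 - y2) = dot x y1 - dot x y2.
Proof. exact: linearBr. Qed.

Lemma dotZl (a : R[i]) x y : dot (a *: x) y = a * dot x y.
Proof. exact: linearZl_LR. Qed.

Lemma dotZr (a : R[i]) x y : dot x (a *: y) = a^*%R * dot x y.
Proof. exact: linearZr_LR. Qed.

Lemma dot_eq0C x y : dot x y = 0 -> dot y x = 0.
Proof. by move=> xy; rewrite dotC xy rmorph0. Qed.

Lemma sqr_normD_ortho x y :
  dot x y = 0 -> `|x + y| ^+ 2 = `|x| ^+ 2 + `|y| ^+ 2.
Proof. by move=> xy; rewrite -!dot_norm; exact: (hnormDd xy). Qed.

Lemma sqr_normB x y :
  `|x - y| ^+ 2 = `|x| ^+ 2 + `|y| ^+ 2 - (dot x y + (dot x y)^*%R).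
Proof. by rewrite -!dot_norm; exact: dnormB. Qed.

(** Cauchy-Schwarz in arbitrary dimension: Pythagoras applied to the component
    a *: y of x along y and the orthogonal rest. *)
Lemma ler_norm_dot x y : `|dot x y| <= `|x| * `|y|.
Proof.
have [->|y0] := eqVneq y 0; first by rewrite dot0r !normr0 mulr0.
have yy0 : `|y| ^+ 2 != 0 by rewrite expf_eq0/= normr_eq0.
pose a := dot x y / `|y| ^+ 2.
have ortho : dot (x - a *: y) (a *: y) = 0.
  by rewrite dotZr dotBl dotZl dot_norm divfK// subrr mulr0.
have le_ay : `|a| * `|y| <= `|x|.
  rewrite -normrZ -(@ler_pXn2r _ 2)// ?nnegrE//.
  by rewrite -[x in leRHS](subrK (a *: y)) (sqr_normD_ortho ortho) lerDr
    exprn_ge0.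
rewrite -[dot x y](divfK yy0) -/a normrM normrX normr_id expr2 mulrA.
exact: ler_wpM2r.
Qed.

Lemma closed_subspace_ortho_compl M :
  closed_subspace (ortho_compl_in dot setT M).
Proof.
split; last 2 first.
- by split=> // y _; rewrite dot0l.
- move=> a x y [_ xM] [_ yM]; split=> // z Mz.
  by rewrite dotDl dotZl xM// yM// mulr0 addr0.
move=> x clx; split=> // y My.
apply/eqP; rewrite -normr_le0; apply/ler_addgt0Pr => e e0; rewrite add0r.
have y1 : 0 < `|y| + 1 :> R[i] by rewrite ltr_wpDl.
have [z [[_ zM]]] := clx _ (nbhsx_ballx x _ (divr_gt0 e0 y1)).
rewrite -ball_normE/= => xz.
rewrite -[dot x y]subr0 -(zM _ My) -dotBl.
apply: le_trans (ler_norm_dot _ _) _.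
apply: le_trans (_ : e / (`|y| + 1) * (`|y| + 1) <= _); last first.
  by rewrite divfK// gt_eqF.
by apply: ler_pM => //; [exact: ltW|rewrite lerDl].
Qed.

(** By self-adjointness the inner product of A^(2m) h and A^(2n) h is
    b (m + n), where b k is the squared norm of A^k h. As A is a contraction, b
    is nonincreasing and nonnegative; the squared distance from A^(2N) h to
    A^(2n) h is b (2N) + b (2n) - 2 b (N + n), at most b N - inf b for n >= N,
    so the even iterates form a Cauchy sequence. The whole sequence need not
    converge: A may be -1. *)
Lemma cvg_iter_even (A : H -> H) h :
    (forall x y, dot (A x) y = dot x (A y)) ->
    (forall x, `|A x| <= `|x|) ->
  exists g : H, iter n.*2 A h @[n --> \oo] --> g.
Proof.
move=> Asym Ale.
(* The norm takes its values in R[i]; the infimum is taken in R. *)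
pose b n : R := complex.Re (`|iter n A h| ^+ 2).
have bE n : (b n)%:C = `|iter n A h| ^+ 2.
  by rewrite /b RRe_real// ger0_real// exprn_ge0.
have b_ge0 n : 0 <= b n by rewrite -lecR bE exprn_ge0.
have b_dec m n : (m <= n)%N -> b n <= b m.
  move=> /subnK <-; elim: (n - m)%N => // k; apply: le_trans.
  by rewrite addSn -lecR !bE lerXn2r ?nnegrE// iterS.
have dot_iter m n : dot (iter m A h) (iter n A h) = dot h (iter (m + n) A h).
  by elim: m n => // m IH n; rewrite iterS Asym -iterS IH addnS.
have dotE m n : dot (iter m.*2 A h) (iter n.*2 A h) = (b (m + n)%N)%:C.
  by rewrite dot_iter bE -dot_norm dot_iter -doubleD addnn.
pose l := inf (range b).
have b_lb : has_lbound (range b) by exists 0 => _ [n _ <-].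
have l_le n : l <= b n by apply: ge_inf => //; exists n.
apply/cvg_ex/cauchy_cvgP/cauchy_exP => e e0.
have eE : (complex.Re e)%:C = e by rewrite RRe_real// gtr0_real.
have r0 : 0 < complex.Re e by rewrite -ltcR eE.
(* The square of e is the accuracy needed, as b measures squared norms. *)
have [|_ [N _ <-] bN] := @inf_adherent _ (range b) _ (exprn_gt0 2 r0).
  by split=> //; exists (b 0%N), 0%N.
exists (iter N.*2 A h).
exists N => // n /= Nn; rewrite -ball_normE/=.
rewrite -(@ltr_pXn2r _ 2)// ?nnegrE ?(ltW e0)// sqr_normB -!dot_norm !dotE.
rewrite conj_Creal ?ger0_real ?lecR// -eE -rmorphXn/= -!rmorphD/= -rmorphB/=.
rewrite ltcR; apply: le_lt_trans (_ : b N - l < _); last by rewrite ltrBlDl.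
have bn : b (n + n)%N <= b (N + n)%N by rewrite b_dec// leq_add2r.
have bNN : b (N + N)%N <= b N by rewrite b_dec// leq_addr.
have ln := l_le (N + n)%N.
by rewrite opprD addrACA -[leRHS]addr0 lerD ?lerB ?subr_le0.
Qed.

Lemma fixed_cvg_iter_even (A : H -> H) h g :
  continuous A -> iter n.*2 A h @[n --> \oo] --> g -> A (A g) = g.
Proof.
move=> Ac ug; apply: (cvg_unique (@norm_hausdorff _ H)) (ug).
have AAu : A (A (iter n.*2 A h)) @[n --> \oo] --> A (A g).
  by apply: continuous_cvg; [exact: Ac|apply: continuous_cvg; [exact: Ac|]].
by rewrite /= -cvg_shiftS.
Qed.

(** Self-adjointness moves A - 1 across the inner product. The fixed space is
    thereby an orthogonal complement, hence a closed subspace. *)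
Lemma fixed_ortho_range (A : H -> H) x :
    (forall x y, dot (A x) y = dot x (A y)) ->
  A x = x <-> forall y, dot x (A y - y) = 0.
Proof.
move=> Asym; have dotE y : dot x (A y - y) = dot (A x - x) y.
  by rewrite dotBr dotBl Asym.
split=> [Ax y|xA]; first by rewrite dotE Ax subrr dot0l.
apply/eqP; rewrite -subr_eq0 -normr_eq0 -sqrf_eq0 -dot_norm.
by rewrite -dotE xA.
Qed.

Lemma unitary_on_id (A : H -> H) M :
  (forall x, M x -> A x = x) -> unitary_on dot A M.
Proof.
move=> AM; split; first by move=> _ [x Mx <-]; rewrite AM.
exists id; split=> //; first by move=> _ [x Mx <-].
by move=> x y Mx _; rewrite AM.
Qed.

End InnerProduct.

(** * Projections and the intersection of their ranges *)

Section Projections.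
Set Implicit Arguments.
Unset Strict Implicit.
Context (R : realType) (H : completeNormedModType R[i]).
Context (dot : {dot H for Num.conj}) (dot_norm : induces_norm dot).
Implicit Types (x y h : H) (M : set H).

Section OneProjection.
Context (P : {linear H -> H}) (P_proj : projection dot P).

Lemma sqr_norm_projection x : `|x| ^+ 2 = `|P x| ^+ 2 + `|x - P x| ^+ 2.
Proof.
case: P_proj => _ Psym PP.
have ortho : dot (P x) (x - P x) = 0 by rewrite Psym linearB/= PP subrr dot0r.
by rewrite -(sqr_normD_ortho dot_norm ortho) addrC subrK.
Qed.

Lemma ler_norm_projection x : `|P x| <= `|x|.
Proof.
rewrite -(@ler_pXn2r _ 2)// ?nnegrE// (sqr_norm_projection x) lerDl.
exact: exprn_ge0.
Qed.

(** Equality of the norms kills the second term of sqr_norm_projection. *)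
Lemma projection_fixed x : `|x| <= `|P x| -> P x = x.
Proof.
move=> xPx; have E : `|P x| = `|x|.
  by apply/le_anti; rewrite xPx ler_norm_projection.
apply/esym/eqP; rewrite -subr_eq0 -normr_eq0 -sqrf_eq0.
by rewrite -(inj_eq (addrI (`|P x| ^+ 2))) -sqr_norm_projection addr0 E.
Qed.

Lemma range_projection : range P = [set x | P x = x].
Proof.
case: P_proj => _ _ PP; apply/seteqP; split=> [_ [x _ <-]|x Px].
  exact: PP.
by exists x.
Qed.

End OneProjection.

Section TwoProjections.
Context (P1 P2 : {linear H -> H}).
Context (P1_proj : projection dot P1) (P2_proj : projection dot P2).

Let U : set H := range P1 `&` range P2.
Let T : H -> H := P1 \o P2.

Lemma common_rangeE : range P1 `&` range P2 = [set x | P1 x = x /\ P2 x = x].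
Proof. by rewrite !range_projection. Qed.

(** |P1 P2 x| <= |P2 x| <= |x|, so the hypothesis makes both projections
    preserve the norm, and a norm-preserved vector is fixed. *)
Lemma common_range_isometric x : `|x| <= `|P1 (P2 x)| -> U x.
Proof.
move=> xT; rewrite /U common_rangeE.
have P2x : P2 x = x.
  apply: (projection_fixed P2_proj); apply: le_trans xT _.
  exact: (ler_norm_projection P1_proj).
by split=> //; apply: (projection_fixed P1_proj); rewrite P2x in xT.
Qed.

Lemma ker_common_range : ker (fun h : H => (P1 \o P2) h - h) = U.
Proof.
apply/seteqP; split=> x /=.
  move/eqP; rewrite subr_eq0 => /eqP Tx.
  by apply: common_range_isometric; rewrite Tx.
by rewrite /ker /U common_rangeE /= => -[P1x P2x]; rewrite P2x P1x subrr.
Qed.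

Lemma closed_subspace_common_range : closed_subspace U.
Proof.
have -> : U = ortho_compl_in dot setT
    [set z | exists y, z = P1 y - y \/ z = P2 y - y].
  case: P1_proj P2_proj => _ P1sym _ [_ P2sym _].
  rewrite /U common_rangeE; apply/seteqP; split=> x /=.
    move=> [/(fixed_ortho_range dot_norm _ P1sym) x1].
    move=> /(fixed_ortho_range dot_norm _ P2sym) x2.
    by split=> // _ [y [->|->]]; [exact: x1|exact: x2].
  move=> [_ xM]; split.
    by apply/(fixed_ortho_range dot_norm _ P1sym) => y; apply: xM; exists y;
      left.
  by apply/(fixed_ortho_range dot_norm _ P2sym) => y; apply: xM; exists y;
    right.
exact: closed_subspace_ortho_compl.
Qed.

(** The limit g of A^(2n) h, with A = P1 P2 P1, satisfies A^2 g = g, so no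
    factor of A^2 shortens it and g lies in U. For y in U, A y = y, so
    self-adjointness gives A^(2n) h and h the same inner product with y; hence
    h - A^(2n) h lies in the closed orthogonal complement of U, and so does the
    limit h - g. *)
Lemma common_range_decomposition :
  orthogonal_decomposition dot U (ortho_compl_in dot setT U).
Proof.
case: (P1_proj) (P2_proj) => P1c P1sym P1P1 [P2c P2sym _].
split=> [x y Ux [_ /(_ _ Ux)]|h]; first exact: dot_eq0C.
have P1_le := ler_norm_projection P1_proj.
have P2_le := ler_norm_projection P2_proj.
pose A x := P1 (P2 (P1 x)).
have Asym x y : dot (A x) y = dot x (A y) by rewrite /A P1sym P2sym P1sym.
have A_le x : `|A x| <= `|x|.
  apply: le_trans (P1_le _) _; apply: le_trans (P2_le _) _; exact: P1_le.
have Ac : continuous A.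
  move=> x; apply: (@continuous_comp _ _ _ (P2 \o P1) P1); last exact: P1c.
  by apply: continuous_comp; [exact: P1c|exact: P2c].
have [g ug] := cvg_iter_even dot_norm h Asym A_le.
have AAg := fixed_cvg_iter_even Ac ug.
have gP1 : P1 g = g.
  apply: (projection_fixed P1_proj); rewrite -{1}AAg.
  apply: le_trans (A_le _) _; rewrite /A.
  by apply: le_trans (P1_le _) _; apply: P2_le.
have Ug : U g.
  apply: common_range_isometric; rewrite -{1}AAg; apply: le_trans (A_le _) _.
  by rewrite /A gP1.
exists g, (h - g); split=> //; last by rewrite addrC subrK.
have [clV _ _] := closed_subspace_ortho_compl dot_norm U.
apply: (closed_cvg _ clV _ _ (cvgB (cvg_cst h) ug)).
apply: nearW => n; split=> // y Uy.
have Ay : A y = y.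
  by move: Uy; rewrite /U common_rangeE /A => -[y1 y2]; rewrite y1 y2.
have uy : dot (iter n.*2 A h) y = dot h y.
  by elim: n.*2 => // k IH; rewrite iterS Asym Ay.
by rewrite dotBl uy subrr.
Qed.

Lemma fixed_common_range x : U x -> T x = x.
Proof. by rewrite /U common_rangeE /T /= => -[x1 x2]; rewrite x2. Qed.

(** The adjoint P2 P1 of T also fixes U, so pairing with a vector of U does not
    see T; this is why T preserves orthogonality to vectors of U. *)
Lemma dot_fixed_common_range x y : U y -> dot (T x) y = dot x y.
Proof.
case: P1_proj P2_proj => _ P1sym _ [_ P2sym _].
by rewrite /U common_rangeE => -[y1 y2]; rewrite P1sym P2sym y1 y2.
Qed.

(** On M the adjoint S is a left inverse of T, so T is isometric on M. *)
Lemma unitary_on_common_range M : unitary_on dot T M -> M `<=` U.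
Proof.
move=> [TM [S [_ adj ST _]]] x Mx; apply: common_range_isometric.
have TMx : M (T x) by apply: TM; exists x.
rewrite -(@ler_pXn2r _ 2)// ?nnegrE// -!dot_norm -[P1 (P2 x)]/(T x).
by rewrite adj// ST.
Qed.

(** Complete non-unitarity of the complement: a subspace of it on which T is
    unitary lies in U too, hence is orthogonal to itself. *)
Lemma canonical_decomposition_common_range :
  canonical_decomposition dot T U (ortho_compl_in dot setT U).
Proof.
have TV x : ortho_compl_in dot setT U x -> ortho_compl_in dot setT U (T x).
  by move=> [_ xU]; split=> // y Uy; rewrite dot_fixed_common_range// xU.
split.
- exact: common_range_decomposition.
- split=> //; first exact: closed_subspace_common_range.
    by move=> _ [x Ux <-]; rewrite fixed_common_range.
  by move=> _ [x Vx <-]; exact: TV.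
- split=> //; first exact: closed_subspace_ortho_compl.
    by move=> _ [x Vx <-]; exact: TV.
  (* The complement of the complement: move T to the other side as P2 P1. *)
  move=> _ [x [_ xV] <-]; split=> // y [_ yU].
  case: P1_proj P2_proj => _ P1sym _ [_ P2sym _].
  rewrite /T /= P1sym P2sym; apply: xV; split=> // z Uz.
  by rewrite P2sym P1sym -[P1 (P2 z)]/(T z) fixed_common_range// yU.
- exact/unitary_on_id/fixed_common_range.
- move=> N [[_ N0 _] NV _ _] N_unitary.
  apply/seteqP; split=> [x Nx|_ ->//].
  have [_ xU] := NV _ Nx.
  have Ux := unitary_on_common_range N_unitary Nx.
  by apply/eqP; rewrite -normr_eq0 -sqrf_eq0 -dot_norm xU.
Qed.

(** Split x in U as u + c. Since u lies in Hu, hence in U, so does c; thus c is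
    in the intersection of U and Hcnu, which is trivial because T reduces to the
    identity there. *)
Lemma canonical_decomposition_unique Hu Hcnu :
  canonical_decomposition dot T Hu Hcnu -> Hu = U.
Proof.
move=> [[_ dec] _ [[clC C0 lC] _ THc _] Hu_unitary cnu].
have HuU := unitary_on_common_range Hu_unitary.
have [clU U0 lU] := closed_subspace_common_range.
have N0 : U `&` Hcnu = [set 0].
  apply: cnu; last first.
    by apply: unitary_on_id => x [Ux _]; exact: fixed_common_range.
  split.
  - split=> //; first exact: closedI.
    by move=> a x y [Ux Cx] [Uy Cy]; split; [exact: lU|exact: lC].
  - by move=> x [].
  - by move=> _ [x [Ux Cx] <-]; rewrite fixed_common_range.
  - move=> _ [x [Cx xN] <-]; split; first by apply: THc; exists x.
    by move=> y [Uy Cy]; rewrite dot_fixed_common_range//; exact: xN.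
apply/seteqP; split=> // x Ux.
have [u [c [Huu Cc xE]]] := dec x.
suff : [set 0] c by move=> c0; rewrite xE c0 addr0.
rewrite -N0; split=> //.
have -> : c = -1 *: u + x by rewrite xE scaleN1r addKr.
by apply: lU => //; exact: HuU.
Qed.

End TwoProjections.
End Projections.

Theorem theorem3p1 (R : realType) (H : completeNormedModType R[i])
    (dot : {dot H for Num.conj}) (dot_norm : induces_norm dot)
    (H_separable : separable H)
    (P1 P2 : {linear H -> H})
    (P1_proj : projection dot P1) (P2_proj : projection dot P2) :
  unitary_part dot (P1 \o P2) = ker (fun h : H => (P1 \o P2) h - h) /\
  ker (fun h : H => (P1 \o P2) h - h) = range P1 `&` range P2.
Proof.
rewrite (ker_common_range dot_norm P1_proj P2_proj); split=> //.
apply: xget_unique => [|Hu [Hcnu]].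
  eexists; exact: canonical_decomposition_common_range.
exact: canonical_decomposition_unique.
Qed.
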